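(* Let ${}^*\mathbb{Q}$ be a non-standard model of the rationals which has countably many elements. Then its completion $\overline{{}^*\mathbb{Q}}$ is real closed, i.e. (1) if $c\in\overline{{}^*\mathbb{Q}}$ satisfies $c>0$, then there is an element $\sqrt{c}\in\overline{{}^*\mathbb{Q}}$ with $\sqrt{c}>0$ and $(\sqrt{c})^2=c$; (2) if $p\in\overline{{}^*\mathbb{Q}}[x]$ is a polynomial of odd degree, then there is $a\in\overline{{}^*\mathbb{Q}}$ with $p(a)=0$.
   Context: A non-standard model of $\mathbb{Q}$ is an ordered field ${}^*\mathbb{Q}$ which is elementarily equivalent but not isomorphic to $\mathbb{Q}$; elementarily equivalent means that a first-order sentence of arithmetic (in the language of ordered fields) is true in ${}^*\mathbb{Q}$ if and only if it is true in $\mathbb{Q}$. A Cauchy sequence in ${}^*\mathbb{Q}$ is a sequence $(a_k)_{k\in\mathbb{N}}$ in ${}^*\mathbb{Q}$, indexed by the standard natural numbers, such that for every $\epsilon\in{}^*\mathbb{Q}$ with $\epsilon>0$ there is $n_\epsilon\in\mathbb{N}$ with $|a_m-a_n|<\epsilon$ for all $m,n>n_\epsilon$. The completion $\overline{{}^*\mathbb{Q}}$ is the set of equivalence classes of Cauchy sequences in ${}^*\mathbb{Q}$, where two sequences are equivalent if their difference tends to $0$ (i.e. is eventually smaller in absolute value than each positive $\epsilon\in{}^*\mathbb{Q}$). With termwise operations and the usual order (the class of $(a_k)$ is positive iff there is $\epsilon\in{}^*\mathbb{Q}$, $\epsilon>0$, with $a_k>\epsilon$ for all sufficiently large $k$),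 it is an ordered field extending ${}^*\mathbb{Q}$. *)

(* Defs.v *)
From HB Require Import structures.
From mathcomp Require Import all_boot all_order all_algebra.
From mathcomp Require Import boolp classical_sets functions cardinality.
From mathcomp Require Import ring lra.

Set Implicit Arguments.
Unset Strict Implicit.
Unset Printing Implicit Defensive.

Import Order.TTheory GRing.Theory Num.Theory.
Local Open Scope ring_scope.

(* First-order logic in the language (0, 1, +, -, *, =, <) of ordered fields. *)
(* Bound variables are de Bruijn indices: [Forall f] and [Exists f] bind the  *)
(* variable 0 of [f] and shift the other ones by 1.                           *)

Inductive of_term : Type :=
| Var of nat
| Zero
| One
| Add of of_term & of_term
| Opp of of_term
| Mul of of_term & of_term.

Inductive of_formula : Type :=
| Equal of of_term & of_term
| Less of of_term & of_term
| Not of of_formula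
| And of of_formula & of_formula
| Or of of_formula & of_formula
| Impl of of_formula & of_formula
| Forall of of_formula
| Exists of of_formula.

Fixpoint term_eval (F : realFieldType) (e : seq F) (t : of_term) : F :=
  match t with
  | Var i => e`_i
  | Zero => 0
  | One => 1
  | Add t1 t2 => term_eval e t1 + term_eval e t2
  | Opp t1 => - term_eval e t1
  | Mul t1 t2 => term_eval e t1 * term_eval e t2
  end.

Fixpoint satisfies (F : realFieldType) (e : seq F) (f : of_formula) : Prop :=
  match f with
  | Equal t1 t2 => term_eval e t1 = term_eval e t2
  | Less t1 t2 => term_eval e t1 < term_eval e t2
  | Not f1 => ~ satisfies e f1
  | And f1 f2 => satisfies e f1 /\ satisfies e f2
  | Or f1 f2 => satisfies e f1 \/ satisfies e f2
  | Impl f1 f2 => satisfies e f1 -> satisfies e f2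
  | Forall f1 => forall x : F, satisfies (x :: e) f1
  | Exists f1 => exists x : F, satisfies (x :: e) f1
  end.

Fixpoint term_vars_lt (n : nat) (t : of_term) : bool :=
  match t with
  | Var i => (i < n)%N
  | Zero | One => true
  | Add t1 t2 | Mul t1 t2 => term_vars_lt n t1 && term_vars_lt n t2
  | Opp t1 => term_vars_lt n t1
  end.

Fixpoint free_vars_lt (n : nat) (f : of_formula) : bool :=
  match f with
  | Equal t1 t2 | Less t1 t2 => term_vars_lt n t1 && term_vars_lt n t2
  | Not f1 => free_vars_lt n f1
  | And f1 f2 | Or f1 f2 | Impl f1 f2 =>
      free_vars_lt n f1 && free_vars_lt n f2
  | Forall f1 | Exists f1 => free_vars_lt n.+1 f1
  end.

Definition sentence (f : of_formula) : bool := free_vars_lt 0 f.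

Definition true_in (F : realFieldType) (f : of_formula) : Prop :=
  satisfies ([::] : seq F) f.

Definition elementarily_equivalent (F G : realFieldType) : Prop :=
  forall f : of_formula, sentence f -> (true_in F f <-> true_in G f).

Definition ordered_field_isomorphic (F G : realFieldType) : Prop :=
  exists h : {rmorphism F -> G}, bijective h /\ {mono h : x y / x <= y}.

Definition nonstandard_rationals (F : realFieldType) : Prop :=
  elementarily_equivalent F rat /\ ~ ordered_field_isomorphic F rat.

Section CauchySequences.
Variable F : realFieldType.
Implicit Types a b : nat -> F.

Definition cauchy a : Prop :=
  forall eps : F, 0 < eps ->
    exists N : nat, forall m n : nat, (N < m)%N -> (N < n)%N ->
      `|a m - a n| < eps.

Definition tends_to0 a : Prop :=
  forall eps : F, 0 < eps ->
    exists N : nat, forall n : nat, (N < n)%N -> `|a n| < eps.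

Definition eventually_gt0 a : Prop :=
  exists eps : F, 0 < eps /\
    exists N : nat, forall n : nat, (N < n)%N -> eps < a n.

Definition cauchyb : {pred nat -> F} := fun a => `[< cauchy a >].

Lemma cauchy_bounded a : cauchy a ->
  exists M : F, 0 < M /\ exists N : nat, forall n, (N < n)%N -> `|a n| <= M.
Proof.
move=> /(_ 1 ltr01) [N hN]; exists (`|a N.+1| + 1); split.
  by rewrite ltr_pwDr.
exists N => n Nn; rewrite -[a n](subrK (a N.+1)) addrC.
by apply: le_trans (ler_normD _ _) _; rewrite lerD2l ltW // hN.
Qed.

Lemma tends_to0_mul a b : cauchy a -> tends_to0 b -> tends_to0 (a * b).
Proof.
move=> /cauchy_bounded [M [M0 [N hN]]] hb eps eps0.
have [N' hN'] := hb (eps / M) (divr_gt0 eps0 M0).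
exists (maxn N N') => n; rewrite gtn_max => /andP[Nn N'n].
rewrite mulrfctE normrM (@le_lt_trans _ _ (M * `|b n|)) //.
  by rewrite ler_wpM2r // hN.
by rewrite mulrC -ltr_pdivlMr // hN'.
Qed.

Lemma cauchyb_subring : subring_closed cauchyb.
Proof.
split.
- by apply/asboolP => eps eps0; exists 0%N => m n _ _; rewrite subrr normr0.
- move=> a b /asboolP ha /asboolP hb; apply/asboolP => eps eps0.
  have e20 : 0 < eps / 2 by rewrite divr_gt0.
  have [Na hNa] := ha _ e20; have [Nb hNb] := hb _ e20.
  exists (maxn Na Nb) => m n; rewrite !gtn_max => /andP[am bm] /andP[an bn].
  have -> : (a - b) m - (a - b) n = (a m - a n) - (b m - b n).
    by rewrite addrfctE opprfctE; ring.
  by rewrite [ltRHS](splitr eps) (le_lt_trans (ler_normB _ _)) // ltrD ?hNa ?hNb.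
- move=> a b /asboolP ha /asboolP hb; apply/asboolP => eps eps0.
  have [A [A0 [Na hA]]] := cauchy_bounded ha.
  have [B [B0 [Nb hB]]] := cauchy_bounded hb.
  have [Na' ha'] := ha _ (divr_gt0 (divr_gt0 eps0 (ltr0n F 2)) B0).
  have [Nb' hb'] := hb _ (divr_gt0 (divr_gt0 eps0 (ltr0n F 2)) A0).
  exists (maxn (maxn Na Nb) (maxn Na' Nb')) => m n; rewrite !gtn_max.
  move=> /andP[/andP[am bm] /andP[am' bm']] /andP[/andP[an bn] /andP[an' bn']].
  have -> : (a * b) m - (a * b) n = a m * (b m - b n) + (a m - a n) * b n.
    by rewrite mulrfctE mulrBr mulrBl addrA subrK.
  rewrite [ltRHS](splitr eps) (le_lt_trans (ler_normD _ _)) // !normrM.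
  apply: ltrD.
    rewrite (@le_lt_trans _ _ (A * `|b m - b n|)) ?ler_wpM2r ?hA //.
    by rewrite mulrC -ltr_pdivlMr // hb'.
  rewrite (@le_lt_trans _ _ (`|a m - a n| * B)) ?ler_wpM2l ?hB //.
  by rewrite -ltr_pdivlMr // ha'.
Qed.

HB.instance Definition _ :=
  GRing.isSubringClosed.Build (nat -> F) cauchyb cauchyb_subring.

Record cauchy_seq : Type :=
  CauchySeq { cauchy_fun : nat -> F; _ : cauchy_fun \in cauchyb }.

HB.instance Definition _ := [isSub for cauchy_fun].
HB.instance Definition _ := [Choice of cauchy_seq by <:].
HB.instance Definition _ := [SubChoice_isSubComNzRing of cauchy_seq by <:].

Definition null_seq : {pred cauchy_seq} := fun u => `[< tends_to0 (val u) >].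

Lemma cauchy_seqP (a : cauchy_seq) : cauchy (val a).
Proof. exact/asboolP/(valP a). Qed.

Lemma null_seq_idealr : idealr_closed null_seq.
Proof.
split.
- by apply/asboolP => eps eps0; exists 0%N => n _; rewrite rmorph0 normr0.
- apply/negP => /asboolP /(_ 1 ltr01) [N /(_ N.+1 (ltnSn N))].
  by rewrite rmorph1 normr1 ltxx.
- move=> a u v /asboolP hu /asboolP hv; apply/asboolP => eps eps0.
  have e20 : 0 < eps / 2 by rewrite divr_gt0.
  have [N hN] := tends_to0_mul (cauchy_seqP a) hu e20.
  have [N' hN'] := hv _ e20.
  exists (maxn N N') => n; rewrite gtn_max => /andP[Nn N'n].
  rewrite rmorphD rmorphM [ltRHS](splitr eps).
  by rewrite (le_lt_trans (ler_normD _ _)) // ltrD ?hN ?hN'.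
Qed.

HB.instance Definition _ := isIdealr.Build cauchy_seq null_seq null_seq_idealr.

(* The ring structure is the termwise one, inherited from the ring            *)
(* [nat -> F] of sequences.                                                   *)
Definition completion : Type := {ideal_quot null_seq}.

HB.instance Definition _ := GRing.ComNzRing.on completion.

Definition cclass (a : cauchy_seq) : completion :=
  (\pi_({ideal_quot null_seq}) a)%qT.
Definition crepr (x : completion) : cauchy_seq :=
  repr (x : {ideal_quot null_seq}).

Lemma creprK x : cclass (crepr x) = x.
Proof. exact: reprK. Qed.

Lemma cclass_eq (a b : cauchy_seq) : cclass a = cclass b <-> tends_to0 (val (a - b)).
Proof.
split=> [/eqP|h]; last apply/eqP; rewrite -Quotient.idealrBE.
  by move/asboolP.
exact/asboolP.
Qed.

Lemma cclass0 : cclass 0 = 0. Proof. exact: rmorph0. Qed.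
Lemma cclass1 : cclass 1 = 1. Proof. exact: rmorph1. Qed.
Lemma cclassD (a b : cauchy_seq) : cclass (a + b) = cclass a + cclass b.
Proof. exact: rmorphD. Qed.
Lemma cclassN (a : cauchy_seq) : cclass (- a) = - cclass a.
Proof. exact: rmorphN. Qed.
Lemma cclassM (a b : cauchy_seq) : cclass (a * b) = cclass a * cclass b.
Proof. exact: rmorphM. Qed.

Lemma cclass_eq0 (a : cauchy_seq) : cclass a = 0 <-> tends_to0 (val a).
Proof. by rewrite -cclass0 cclass_eq subr0. Qed.

Lemma cauchy_sign a : cauchy a -> ~ tends_to0 a ->
  eventually_gt0 a \/ eventually_gt0 (- a).
Proof.
move=> ca /existsNP[e /not_implyP[e0 /forallNP hN]].
have e20 : 0 < e / 2 by rewrite divr_gt0.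
have [N hc] := ca _ e20.
have /existsNP[n /not_implyP[Nn /negP]] := hN N; rewrite -leNgt => en.
have [an|an] := leP 0 (a n).
- left; exists (e / 2); split => //; exists N => m Nm.
  have := hc _ _ Nm Nn; rewrite ger0_norm // in en.
  by rewrite ltr_norml => /andP[h _]; lra.
- right; exists (e / 2); split => //; exists N => m Nm.
  have := hc _ _ Nm Nn; rewrite ltr0_norm // in en.
  by rewrite ltr_norml opprfctE => /andP[_ h]; lra.
Qed.

Lemma cauchy_away0 a : cauchy a -> ~ tends_to0 a ->
  exists d : F, 0 < d /\
    exists N : nat, forall n : nat, (N < n)%N -> d < `|a n|.
Proof.
move=> ca na.
have [|] := cauchy_sign ca na => -[d [d0 [N hN]]]; exists d; split => //;
  exists N => n /hN h; first exact: lt_le_trans h (ler_norm _).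
by rewrite -normrN; exact: lt_le_trans h (ler_norm _).
Qed.

Lemma eventually_gt0_equiv a b :
  tends_to0 (a - b) -> eventually_gt0 a -> eventually_gt0 b.
Proof.
move=> h [e [e0 [N hN]]]; have e20 : 0 < e / 2 by rewrite divr_gt0.
have [N' hN'] := h _ e20; exists (e / 2); split => //.
exists (maxn N N') => n; rewrite gtn_max => /andP[/hN h1 /hN'].
by rewrite addrfctE opprfctE ltr_norml => /andP[_ h2]; lra.
Qed.

Definition cpositive (x : completion) : Prop := eventually_gt0 (val (crepr x)).

Lemma cpositiveE (a : cauchy_seq) : cpositive (cclass a) <-> eventually_gt0 (val a).
Proof.
have /cclass_eq h := creprK (cclass a).
split; apply: eventually_gt0_equiv; first by rewrite -rmorphB.
have /esym/cclass_eq h' := creprK (cclass a).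
by rewrite -rmorphB.
Qed.

Lemma cauchy_inv a : cauchy a -> ~ tends_to0 a -> cauchy (fun n => (a n)^-1).
Proof.
move=> ca na.
have [d [d0 [N hN]]] := cauchy_away0 ca na.
move=> e e0; have [N' hN'] := ca _ (mulr_gt0 e0 (mulr_gt0 d0 d0)).
exists (maxn N N') => m n; rewrite !gtn_max => /andP[Nm N'm] /andP[Nn N'n].
have dm := hN _ Nm; have dn := hN _ Nn.
have am : a m != 0 by rewrite -normr_gt0 (lt_trans d0).
have an : a n != 0 by rewrite -normr_gt0 (lt_trans d0).
have -> : (a m)^-1 - (a n)^-1 = (a n - a m) / (a m * a n).
  by field; rewrite am an.
rewrite normrM normfV ltr_pdivrMr ?normr_gt0 ?mulf_neq0 //.
apply: lt_le_trans (hN' _ _ N'n N'm) _.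
by rewrite (ler_wpM2l (ltW e0)) // normrM ler_pM ?(ltW d0) ?(ltW dm) ?(ltW dn).
Qed.

Definition cinv (x : completion) : completion :=
  if x == 0 then 0
  else cclass (insubd (0 : cauchy_seq) (fun n => (val (crepr x) n)^-1)).

Lemma cmulVf x : x != 0 -> cinv x * x = 1.
Proof.
move=> x0; rewrite /cinv (negbTE x0).
have nx : ~ tends_to0 (val (crepr x)).
  by move=> /cclass_eq0; rewrite creprK; exact/eqP.
have cx := cauchy_seqP (crepr x).
rewrite -[X in _ * X]creprK -cclassM -cclass1.
apply/cclass_eq => e e0.
have [d [d0 [N hN]]] := cauchy_away0 cx nx.
exists N => n /hN dn; rewrite rmorphB rmorphM rmorph1 /= val_insubd.
rewrite ifT; last by apply/asboolP/cauchy_inv.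
rewrite addrfctE mulrfctE opprfctE mulVf ?subrr ?normr0 //.
by rewrite -normr_gt0 (lt_trans d0).
Qed.

Lemma cinv0 : cinv 0 = 0. Proof. by rewrite /cinv eqxx. Qed.

HB.instance Definition _ := GRing.ComNzRing_isField.Build completion cmulVf cinv0.

Definition clt (x y : completion) : bool := `[< cpositive (y - x) >].
Definition cle (x y : completion) : bool := (x == y) || clt x y.
Definition cnorm (x : completion) : completion := if cle 0 x then x else - x.

Lemma clt0E (a : cauchy_seq) : clt 0 (cclass a) <-> eventually_gt0 (val a).
Proof.
rewrite -cpositiveE -[X in cpositive X]subr0.
by split=> [/asboolP|?]; last exact/asboolP.
Qed.

Lemma clt0_add x y : clt 0 x -> clt 0 y -> clt 0 (x + y).
Proof.
rewrite -[x]creprK -[y]creprK -cclassD !clt0E.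
move=> [d [d0 [N hN]]] [e [e0 [N' hN']]]; exists (d + e); split.
  exact: addr_gt0.
exists (maxn N N') => n; rewrite gtn_max => /andP[/hN h /hN' h'].
by rewrite rmorphD addrfctE ltrD.
Qed.

Lemma clt0_mul x y : clt 0 x -> clt 0 y -> clt 0 (x * y).
Proof.
rewrite -[x]creprK -[y]creprK -cclassM !clt0E.
move=> [d [d0 [N hN]]] [e [e0 [N' hN']]]; exists (d * e); split.
  exact: mulr_gt0.
exists (maxn N N') => n; rewrite gtn_max => /andP[/hN h /hN' h'].
by rewrite rmorphM mulrfctE ltr_pM // ltW.
Qed.

Lemma csub_gt0 x y : clt 0 (y - x) = clt x y.
Proof. by rewrite /clt subr0. Qed.

Lemma clt0_ngt0 x : clt 0 x -> ~~ clt x 0.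
Proof.
rewrite -[clt x 0]csub_gt0 sub0r => x0; apply/negP => /(clt0_add x0).
rewrite subrr -{2}cclass0 clt0E => -[d [d0 [N /(_ _ (ltnSn N))]]].
by rewrite rmorph0 => /(lt_trans d0); rewrite ltxx.
Qed.

Lemma clt0_total x : x != 0 -> clt 0 x || clt x 0.
Proof.
rewrite -[clt x 0]csub_gt0 sub0r -[x]creprK -cclassN => x0; apply/orP.
have [||h|h] := @cauchy_sign (val (crepr x)).
- exact: cauchy_seqP.
- by move=> /cclass_eq0 /eqP; apply/negP.
- by left; apply/clt0E.
- by right; apply/clt0E; rewrite rmorphN.
Qed.

Lemma cnormN x : cnorm (- x) = cnorm x.
Proof.
have [->|x0] := eqVneq x 0; first by rewrite oppr0.
rewrite /cnorm /cle ![0 == _]eq_sym oppr_eq0 (negbTE x0) /=.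
have -> : clt 0 (- x) = clt x 0 by rewrite -[clt x 0]csub_gt0 sub0r.
have [h|h] := boolP (clt 0 x); first by rewrite (negbTE (clt0_ngt0 h)) opprK.
by have := clt0_total x0; rewrite (negbTE h) /= => ->.
Qed.

Lemma cge0_norm x : cle 0 x -> cnorm x = x.
Proof. by rewrite /cnorm => ->. Qed.

HB.instance Definition _ := Num.IntegralDomain_isLtReal.Build completion
  clt0_add clt0_mul clt0_ngt0 csub_gt0 clt0_total cnormN cge0_norm
  (fun x y => erefl (cle x y)).

Lemma cclass_gt0 (a : cauchy_seq) : 0 < cclass a <-> eventually_gt0 (val a).
Proof. exact: clt0E. Qed.

End CauchySequences.

(* Main.v *)
Require Import Defs.
From HB Require Import structures.
From mathcomp Require Import all_boot all_order all_algebra.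
From mathcomp Require Import boolp classical_sets functions cardinality.
From mathcomp Require Import ring lra zify.

Import Order.TTheory GRing.Theory Num.Theory.
Local Open Scope classical_set_scope.
Local Open Scope ring_scope.

(** Write F for the given field and K for its completion.  Both conclusions
follow from an intermediate value theorem for polynomials over K whose end
points lie in F ([dense_ivt]): a positive c has a square root because 'X^2 - c
changes sign between 0 and a large element of F, and a polynomial of odd degree
changes sign between - M and M for M large, and F is cofinal in K.

The intermediate value theorem is proved with nested intervals.  The field F
need not be archimedean, so bisection does not make the lengths of the intervals
tend to 0.  Instead one step passes from an interval on which p changes sign to
a subinterval, with end points in F, on which p changes sign and whose length is
below a prescribed positive element of F ([sign_change_refine]).  As F is
countable, it has a positive null sequence ([countable_null_sequence]); the
steps, carried out with these lengths, give a Cauchy sequence of end points,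
whose limit is a root of p by continuity.

One step for a polynomial over the archimedean field of rationals is a finite
search on a grid, and it carries over to F because F is elementarily equivalent
to the rationals.  The polynomial p however has its coefficients in K, and is
only approximated by polynomials q over F; a sign change of q at points where q
is tiny says nothing about p.  So the property that is transferred is a uniform
one, [robust_ivt]: there is d > 0, depending on the interval, on a bound for the
degree, on a lower bound c for the size of q at the end points and on the length
eps, such that every such q goes from - d or below to d or above on a
subinterval shorter than eps.  For each degree bound this is a first-order
sentence, and a q closer to p than d then shows the sign change of p.

Over an archimedean field [robust_ivt] holds because a polynomial of size at
most m that is at most d in absolute value at m points with gaps at least h is
at most a constant times d at any point nearby ([small_on_separated]).  Hence
among any m consecutive points of a grid one has a value larger than d in
absolute value, as otherwise q would be smaller than c at the left end point. *)

(** * Sign changes of polynomials over an archimedean field *)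

Lemma factor_increment {R : comNzRingType} (p : {poly R}) (z : R) :
  exists2 r : {poly R}, (size r <= (size p).-1)%N &
    forall x, p.[x] = p.[z] + (x - z) * r.[x].
Proof.
elim/poly_ind: p => [|p c [r sr hr]].
  by exists 0 => [|x]; rewrite ?size_poly0 // !horner0 mulr0 addr0.
have [p0|p0] := eqVneq p 0.
  exists 0 => [|x]; first by rewrite size_poly0.
  by rewrite p0 mul0r add0r !hornerC mulr0 addr0.
exists (r * 'X + p.[z]%:P) => [|x].
  rewrite size_MXaddC [X in (_ <= X.-1)%N]size_MXaddC (negbTE p0) /=.
  by case: ifP => // _; have := size_poly_gt0 p; rewrite p0; case: (size p) sr.
by rewrite !hornerMXaddC (hr x); ring.
Qed.

(** The constant of [small_on_separated], with t standing for the ratio L / h of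
the largest distance to the smallest gap. *)
Fixpoint separated_gain {R : realFieldType} (t : R) (m : nat) : R :=
  if m is m'.+1 then 1 + 2 * t * separated_gain t m' else 0.

Lemma separated_gain_ge0 {R : realFieldType} (t : R) m :
  0 <= t -> 0 <= separated_gain t m.
Proof. by move=> t0; elim: m => //= m IH; rewrite addr_ge0 // !mulr_ge0. Qed.

(** A quantitative form of the bound on the number of roots.  If z is the first
of the points, q = q(z) + (X - z) r with r of smaller size, and |r| is at most
2 d / h on the remaining points, which are at distance at least h from z; so the
claim for q at a follows from the one for r. *)
Lemma small_on_separated {R : realFieldType} (L h : R) (a : R) (s : seq R) :
    0 < h -> pairwise (fun x y => h <= `|x - y|) s ->
    all (fun x => `|a - x| <= L) s ->
  forall (q : {poly R}) (d : R), (size q <= size s)%N ->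
    all (fun x => `|q.[x]| <= d) s ->
  `|q.[a]| <= d * separated_gain (L / h) (size s).
Proof.
move=> h0; elim: s => [|z s IH] /=.
  by move=> _ _ q d; rewrite leqn0 size_poly_eq0 => /eqP-> _;
  rewrite horner0 normr0 mulr0.
move=> /andP[hz hs] /andP[az as_] q d sq /andP[qz qs].
have [r sr hr] := factor_increment q z.
have L0 : 0 <= L := le_trans (normr_ge0 _) az.
have d0 : 0 <= d := le_trans (normr_ge0 _) qz.
have ra : `|r.[a]| <= (2 * d / h) * separated_gain (L / h) (size s).
  apply: IH => //; first by rewrite (leq_trans sr) //; case: (size q) sq.
  apply/allP => x xs; rewrite ler_pdivlMr //.
  have hzx : h <= `|z - x| := allP hz x xs.
  apply: (@le_trans _ _ (`|r.[x]| * `|x - z|)).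
    by rewrite ler_wpM2l // distrC.
  have -> : `|r.[x]| * `|x - z| = `|q.[x] - q.[z]|.
    by rewrite -normrM (hr x); congr `|_|; ring.
  rewrite (le_trans (ler_normB _ _)) // mulr2n mulrDl !mul1r.
  by rewrite lerD // (allP qs).
rewrite (hr a) (le_trans (ler_normD _ _)) // normrM mulrDr mulr1 lerD //.
apply: (@le_trans _ _ (L * ((2 * d / h) * separated_gain (L / h) (size s)))).
  by rewrite ler_pM.
by rewrite le_eqVlt; apply/orP; left; apply/eqP; ring.
Qed.

(** The uniformity in q, that is, the place of the quantifier on d, is what lets
the conclusion survive a small perturbation of the coefficients of q. *)
Definition robust_ivt (R : realFieldType) (m : nat) : Prop :=
  forall a b c eps : R, a < b -> 0 < c -> 0 < eps ->
  exists2 d : R, 0 < d & forall q : {poly R}, (size q <= m)%N ->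
    q.[a] <= - c -> c <= q.[b] ->
    exists x y : R, [/\ a <= x, x < y, y <= b, y - x < eps &
                      q.[x] <= - d /\ d <= q.[y]].

(** On a grid of step h from a to b, take the last point x where q is at most
- d.  One of the m points after x has a value of absolute value above d by
[small_on_separated], and this value is positive since x is last; if fewer than
m points follow x, the point b does. *)
Lemma archimedean_robust_ivt (R : archiRealFieldType) m : robust_ivt R m.
Proof.
move=> a b c eps ab c0 e0; have ba0 : 0 < b - a by rewrite subr_gt0.
pose N := Num.bound ((b - a) * m.+1%:R / eps).
have hN : (b - a) * m.+1%:R / eps < N%:R.
  by rewrite archi_boundP // divr_ge0 ?mulr_ge0 // ltW.
have N0 : 0 < N%:R :> R by rewrite (le_lt_trans _ hN) // divr_ge0 ?mulr_ge0 // ltW.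
pose h := (b - a) / N%:R; have h0 : 0 < h by rewrite divr_gt0.
have mh : m.+1%:R * h < eps.
  move: hN; rewrite ltr_pdivrMr // /h => hN.
  by rewrite mulrA ltr_pdivrMr // mulrC [X in _ < X]mulrC.
(* The choice of d makes d * C < c, so that small values at m consecutive grid
   points contradict q.[a] <= - c, and d <= c, so that b is a point of value at
   least d. *)
pose C := separated_gain ((b - a) / h) m.
have C0 : 0 <= C by rewrite separated_gain_ge0 // divr_ge0 // ltW.
pose d := c / (C + 1).
have C1 : 0 < C + 1 by lra.
have d0 : 0 < d by rewrite divr_gt0.
have dc : d * C < c.
  by rewrite /d mulrAC ltr_pdivrMr // mulrDr mulr1 ltrDl.
have dlec : d <= c by rewrite /d ler_pdivrMr // mulrDr mulr1 lerDr mulr_ge0 // ltW.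
exists d => // q sq qa qb.
pose t (i : nat) := a + i%:R * h.
have t0 : t 0%N = a by rewrite /t mul0r addr0.
have tN : t N = b.
  by rewrite /t /h mulrC divfK ?subrKC // gt_eqF.
have tB i j : t j - t i = (j%:R - i%:R) * h by rewrite /t; ring.
have tle i j : (i <= j)%N -> t i <= t j.
  by move=> ij; rewrite -subr_ge0 tB mulr_ge0 ?subr_ge0 ?ler_nat // ltW.
pose P i := (i <= N)%N && (q.[t i] <= - d).
have P0 : exists i, P i by exists 0%N; rewrite /P t0 (le_trans qa) // lerN2.
have PN i : P i -> (i <= N)%N by move=> /andP[].
case: (ex_maxnP P0 PN) => i /andP[iN qi] imax.
have step j : (i < j)%N -> (j <= N)%N -> (j <= i + m.+1)%N -> d <= q.[t j] ->
    exists x y, [/\ a <= x, x < y, y <= b, y - x < eps &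
      q.[x] <= - d /\ d <= q.[y]].
  move=> ij jN jm qj; exists (t i), (t j); split => //.
  - by rewrite -t0 tle.
  - by rewrite -subr_gt0 tB mulr_gt0 // subr_gt0 ltr_nat.
  - by rewrite -tN tle.
  - rewrite tB (le_lt_trans _ mh) // ler_pM2r // lerBlDl -natrD ler_nat //.
have iltN : (i < N)%N.
  rewrite ltn_neqAle iN andbT; apply/negP => /eqP iE.
  by move: qi; rewrite iE tN => qi; lra.
have [im|im] := leqP (i + m) N; last first.
  apply: (step N) => //; last by rewrite tN (le_trans dlec).
  by rewrite addnS ltnW // ltnS ltnW.
have [j hj] : exists j, [/\ (i < j)%N, (j <= i + m)%N & d < `|q.[t j]|].
  apply: contrapT => /forallNP no.
  have : `|q.[a]| <= d * C.
    rewrite /C -[m](size_iota i.+1) -(size_map t).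
    apply: small_on_separated => //.
    - rewrite pairwise_map.
      have := iota_ltn_sorted i.+1 m; rewrite (sorted_pairwise ltn_trans).
      apply: sub_pairwise => j k /= jk.
      rewrite distrC ger0_norm ?subr_ge0 ?tle ?(ltnW jk) // tB.
      by rewrite ler_peMl ?(ltW h0) // lerBrDr nat1r ler_nat.
    - rewrite all_map; apply/allP => j; rewrite mem_iota => /= /andP[_ jm].
      rewrite -tN -t0 distrC ger0_norm ?subr_ge0 ?tle // lerD2r tle //.
      by rewrite (leq_trans _ im) // -ltnS -addSn.
    - by rewrite size_map size_iota.
    - rewrite all_map; apply/allP => j; rewrite mem_iota => /= /andP[ij jm].
      by rewrite leNgt; apply/negP => dj; apply: (no j); split.
  by rewrite ler0_norm; lra.
case: hj => ij jm; rewrite ltNge ler_norml negb_and -!ltNge => /orP[qj|/ltW qj].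
  have Pj : P j by rewrite /P (leq_trans jm im) ltW.
  by have := imax _ Pj; rewrite leqNgt ij.
by apply: (step j) => //; [exact: leq_trans jm im|rewrite addnS leqW].
Qed.

(** * Transfer along elementary equivalence *)

Definition Leq (t1 t2 : of_term) : of_formula := Not (Less t2 t1).

(** The polynomial evaluated at t has the values of the variables k, ...,
k + m - 1 as its coefficients. *)
Fixpoint horner_term (m k : nat) (t : of_term) : of_term :=
  if m is m'.+1 then Add (Mul (horner_term m' k.+1 t) t) (Var k) else Zero.

(** The coefficients of q are m separate universally quantified variables.
Outermost first, the quantifiers bind a, b, c, eps, d, the coefficients, x and
y.  Below the coefficients, d, eps, c, b and a are thus the variables m, m + 1,
..., m + 4, and these numbers grow by 2 below x and y. *)
Definition robust_ivt_formula (m : nat) : of_formula :=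
  Forall (Forall (Forall (Forall
   (Impl (Less (Var 3) (Var 2)) (Impl (Less Zero (Var 1)) (Impl (Less Zero (Var 0))
    (Exists (And (Less Zero (Var 0)) (iter m Forall
      (Impl (Leq (horner_term m 0 (Var (m + 4))) (Opp (Var (m + 2))))
      (Impl (Leq (Var (m + 2)) (horner_term m 0 (Var (m + 3))))
        (Exists (Exists
          (And (Leq (Var (m + 4).+2) (Var 1))
          (And (Less (Var 1) (Var 0))
          (And (Leq (Var 0) (Var (m + 3).+2))
          (And (Less (Add (Var 0) (Opp (Var 1))) (Var (m + 1).+2))
          (And (Leq (horner_term m 2 (Var 1)) (Opp (Var (m + 0).+2)))
               (Leq (Var (m + 0).+2) (horner_term m 2 (Var 0))))))))))))))))))))).

Lemma free_vars_iter_Forall n m f :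
  free_vars_lt n (iter m Forall f) = free_vars_lt (m + n) f.
Proof. by elim: m n => //= m IH n; rewrite IH addnS. Qed.

Lemma horner_term_vars n m k t :
  (m + k <= n)%N -> term_vars_lt n t -> term_vars_lt n (horner_term m k t).
Proof.
elim: m k => //= m IH k mk ht; rewrite ht IH //; last by rewrite addnS.
by rewrite (leq_trans _ mk) // addSn ltnS leq_addl.
Qed.

Lemma robust_ivt_sentence m : sentence (robust_ivt_formula m).
Proof.
rewrite /sentence /= free_vars_iter_Forall /=.
by rewrite !horner_term_vars /=; lia.
Qed.

Section Satisfaction.
Variable F : realFieldType.
Implicit Types e s : seq F.

Lemma satisfies_Leq e t1 t2 :
  satisfies e (Leq t1 t2) <-> term_eval e t1 <= term_eval e t2.
Proof. by rewrite leNgt /=; split => /negP. Qed.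

(** The list s collects the values of the m quantified variables, the innermost
one first. *)
Lemma satisfies_iter_Forall e m f :
  satisfies e (iter m Forall f) <->
  forall s, size s = m -> satisfies (s ++ e) f.
Proof.
elim: m e => [|m IH] e.
  by split=> [h s /size0nil-> //|/(_ [::] erefl)].
rewrite iterS /=; split=> [h s|h x].
  case/lastP: s => // s x; rewrite size_rcons cat_rcons => -[sm].
  exact: (IH (x :: e)).1 (h x) s sm.
by apply/IH => s sm; rewrite -cat_rcons; apply: h; rewrite size_rcons sm.
Qed.

Lemma horner_termE e1 s e2 t (e := e1 ++ s ++ e2) :
  term_eval e (horner_term (size s) (size e1) t) = (Poly s).[term_eval e t].
Proof.
rewrite horner_Poly {}/e; elim: s e1 => //= x s IH e1.
have := IH (rcons e1 x); rewrite size_rcons cat_rcons => ->.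
by rewrite nth_cat ltnn subnn.
Qed.

Lemma nth_cat_size e s i : (s ++ e)`_(size s + i) = e`_i.
Proof. by rewrite nth_cat ltnNge leq_addr addKn. Qed.

(** Lists of length m give exactly the polynomials of size at most m: such a
list may end with zeros. *)
Lemma robust_ivt_formulaP m :
  true_in F (robust_ivt_formula m) <-> robust_ivt F m.
Proof.
split=> [h a b c eps ab c0 e0|h a b c eps /= ab c0 e0].
  have /= [d [d0 /satisfies_iter_Forall hd]] := h a b c eps ab c0 e0.
  exists d => // q qm qa qb.
  pose s := mkseq (nth 0 q) m; have sm : size s = m by rewrite size_mkseq.
  have qE : q = Poly s.
    apply/polyP => i; rewrite coef_Poly; have [im|mi] := ltnP i m.
      by rewrite nth_mkseq.
    by rewrite !nth_default ?sm // (leq_trans qm).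
  have := hd s sm; rewrite -sm => /(_ _) {}hd.
  have := horner_termE [::] s [:: d; eps; c; b; a].
  have := fun y x => horner_termE [:: y; x] s [:: d; eps; c; b; a].
  rewrite /= => hyx hn; move: hd.
  have lt_impl (x y : F) : x <= y -> ~ (y < x) by rewrite leNgt => /negP.
  case; rewrite /= ?hn /= ?nth_cat_size //= -?qE; first exact: lt_impl.
    exact: lt_impl.
  move=> x [y]; rewrite ?nth_cat_size !hyx /= -qE =>
    -[/negP ax [xy [/negP yb [yx [/negP qx /negP qy]]]]].
  by exists x, y; rewrite !leNgt.
have [d d0 hd] := h a b c eps ab c0 e0; exists d; split=> //.
apply/satisfies_iter_Forall => s sm /=; rewrite -sm.
have := horner_termE [::] s [:: d; eps; c; b; a].
have := fun y x => horner_termE [:: y; x] s [:: d; eps; c; b; a].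
rewrite /= => hyx hn; rewrite !hn /= !nth_cat_size /= => /negP qa /negP qb.
have sq : (size (Poly s) <= m)%N by rewrite -sm size_Poly.
rewrite -!leNgt in qa qb; have [x [y [ax xy yb yx [qx qy]]]] := hd _ sq qa qb.
exists x, y; rewrite !hyx /=.
by do !split=> //; apply/negP; rewrite -leNgt.
Qed.

End Satisfaction.

Lemma robust_ivt_transfer (F : realFieldType) m :
  elementarily_equivalent F rat -> robust_ivt F m.
Proof.
move=> /(_ _ (robust_ivt_sentence m))[_ h]; apply/robust_ivt_formulaP/h.
exact/robust_ivt_formulaP/archimedean_robust_ivt.
Qed.

(** * Bounds on values of polynomials *)

Lemma horner_norm_le {R : realDomainType} (p : {poly R}) n (eta M x : R) :
    (size p <= n)%N -> (forall i, `|p`_i| <= eta) -> `|x| <= M ->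
  `|p.[x]| <= eta * \sum_(i < n) M ^+ i.
Proof.
move=> pn pe xM; rewrite (horner_coef_wide x pn) mulr_sumr.
rewrite (le_trans (ler_norm_sum _ _ _)) // ler_sum // => i _.
by rewrite normrM ler_pM // normrX lerXn2r // ?nnegrE // (le_trans _ xM).
Qed.

Lemma horner_continuous {R : realFieldType} (p : {poly R}) (z eps : R) :
  0 < eps -> exists2 eta : R, 0 < eta &
    forall t, `|t - z| <= eta -> `|p.[t] - p.[z]| < eps.
Proof.
move=> e0; have [r _ hr] := factor_increment p z.
pose B := (\sum_(i < size r) `|r`_i|) * \sum_(i < size r) (`|z| + 1) ^+ i.
have B0 : 0 <= B.
  by rewrite mulr_ge0 // sumr_ge0 // => i _; rewrite exprn_ge0 // addr_ge0.
have B1 : 0 < B + 1 by lra.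
have rB t : `|t - z| <= 1 -> `|r.[t]| <= B.
  move=> tz; apply: horner_norm_le => // [i|].
    have [ir|ri] := ltnP i (size r); last by rewrite nth_default // normr0 sumr_ge0.
    by rewrite (bigD1 (Ordinal ir)) //= lerDl sumr_ge0.
  by rewrite -[t](subrK z) addrC (le_trans (ler_normD _ _)) // lerD2l.
exists (Num.min 1 (eps / (B + 1))); first by rewrite lt_min ltr01 divr_gt0.
move=> t; rewrite le_min => /andP[/rB rt tz].
rewrite (hr t) addrC addKr normrM.
rewrite (@le_lt_trans _ _ (eps / (B + 1) * B)) ?ler_pM //.
by rewrite mulrAC ltr_pdivrMr // ltr_pM2l //; lra.
Qed.

(** * Roots in a complete field containing a dense subfield

The completion enters only through an order embedding f of F with dense and
coinitial image, along which Cauchy sequences of F converge. *)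

Section DenseSubfield.
Variables (F K : realFieldType) (f : {rmorphism F -> K}).
Hypothesis f_le : {mono f : r s / r <= s}.
Hypothesis f_coinitial : forall x : K, 0 < x -> exists2 e : F, 0 < e & f e <= x.
Hypothesis f_dense : forall (x : K) (e : F), 0 < e -> exists r, `|x - f r| <= f e.

Let f_lt : {mono f : r s / r < s}.
Proof. exact: leW_mono. Qed.

Let f_gt0 r : (0 < f r) = (0 < r).
Proof. by rewrite -(rmorph0 f) f_lt. Qed.

Let f_norm r : `|f r| = f `|r|.
Proof.
have [r0|r0] := leP 0 r; first by rewrite !ger0_norm // -(rmorph0 f) f_le.
by rewrite !ltr0_norm ?rmorphN // -(rmorph0 f) f_lt.
Qed.

Let f_cofinal (x : K) : exists2 e : F, 0 < e & x <= f e.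
Proof.
have [e e0 he] : exists2 e, 0 < e & f e <= (`|x| + 1)^-1.
  by apply: f_coinitial; rewrite invr_gt0 ltr_wpDl.
exists e^-1; first by rewrite invr_gt0.
rewrite fmorphV (le_trans (ler_norm x)) // (@le_trans _ _ (`|x| + 1)) ?lerDl //.
by rewrite -[leLHS]invrK lef_pV2 ?posrE ?f_gt0 // invr_gt0 ltr_wpDl.
Qed.

Lemma poly_dense (p : {poly K}) e : 0 < e ->
  exists2 q : {poly F}, (size q <= size p)%N &
    forall i, `|(p - map_poly f q)`_i| <= f e.
Proof.
move=> e0; have /choice[r hr] := fun i => f_dense p`_i e e0.
exists (\poly_(i < size p) r i) => [|i]; first exact: size_poly.
rewrite coefB coef_map coef_poly; have [ip|pi] := ltnP i (size p) => //=.
by rewrite nth_default // rmorph0 subr0 normr0 ltW // f_gt0.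
Qed.

Hypothesis Frobust : forall m, robust_ivt F m.

(** The step of the nested intervals.  Choose c in F so that p is at most - 2 c
and at least 2 c at the end points, let d be the margin given by [robust_ivt],
and approximate p by a polynomial q over F up to w, the smaller of c and d / 2,
on the whole interval.  Then q still has values beyond - c and c at the end
points, and where q is beyond - d or d, p keeps the sign of q. *)
Lemma sign_change_refine (p : {poly K}) (a b eps : F) :
    a < b -> 0 < eps -> p.[f a] < 0 -> 0 < p.[f b] ->
  exists x y : F, [/\ a <= x, x < y, y <= b, y - x < eps &
    p.[f x] < 0 /\ 0 < p.[f y]].
Proof.
move=> ab e0 pa pb.
have [c c0 hc] : exists2 c, 0 < c &
    f c + f c <= Num.min (- p.[f a]) p.[f b].
  have /f_coinitial[c c0 hc] : 0 < Num.min (- p.[f a]) p.[f b].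
    by rewrite lt_min oppr_gt0 pa.
  exists (c / 2); first by rewrite divr_gt0.
  by rewrite -rmorphD -splitr.
move: hc; rewrite le_min => /andP[hca hcb].
have [d d0 hd] := Frobust (size p) a b c eps ab c0 e0.
pose M := `|a| + `|b|; pose S := \sum_(i < size p) M ^+ i.
have S0 : 0 <= S by rewrite sumr_ge0 // => i _; rewrite exprn_ge0 // addr_ge0.
have S1 : 0 < S + 1 by lra.
(* An error eta on the coefficients gives an error of at most eta * S on the
   values, by [horner_norm_le]. *)
pose w := Num.min c (d / 2); pose eta := w / (S + 1).
have w0 : 0 < w by rewrite lt_min c0 divr_gt0.
have eta0 : 0 < eta by rewrite divr_gt0.
have etaS : eta * S <= w.
  by rewrite /eta mulrAC ler_pdivrMr // ler_pM2l //; lra.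
have [q qp hq] := poly_dense p eta eta0.
have pq t : a <= t -> t <= b -> `|p.[f t] - f q.[t]| <= f w.
  move=> at_ tb; rewrite -horner_map -hornerN -hornerD.
  apply: (@le_trans _ _ (f (eta * S))); last by rewrite f_le.
  rewrite rmorphM rmorph_sum; under eq_bigr do rewrite rmorphXn.
  apply: horner_norm_le => //.
    by rewrite (leq_trans (size_polyD _ _)) // size_polyN geq_max leqnn size_map_poly.
  rewrite f_norm f_le ler_norml /M.
  have := ler_norm a; have := ler_norm (- a); have := ler_norm b.
  by have := ler_norm (- b); rewrite !normrN; lra.
have wc : f w <= f c by rewrite f_le ge_min lexx.
have wd : f w < f d by rewrite f_lt /w gt_min; apply/orP; right; lra.
have qa : q.[a] <= - c.
  have := pq a (lexx _) (ltW ab); rewrite -f_le rmorphN ler_distl => /andP[].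
  by lra.
have qb : c <= q.[b].
  have := pq b (ltW ab) (lexx _); rewrite -f_le ler_distl => /andP[].
  by lra.
have [x [y [ax xy yb yx [qx qy]]]] := hd q qp qa qb.
exists x, y; split=> //.
move: qx qy; rewrite -!f_le rmorphN => qx qy.
have := pq x ax (le_trans (ltW xy) yb); rewrite ler_distl => /andP[? ?].
have := pq y (le_trans ax (ltW xy)) yb; rewrite ler_distl => /andP[? ?].
by split; lra.
Qed.

Hypothesis f_complete : forall u : nat -> F, cauchy u -> exists z : K,
  forall r e : F, (exists N, forall n, (N < n)%N -> `|u n - r| <= e) ->
  `|z - f r| <= f e.
Hypothesis F_null : exists e : nat -> F, (forall k, 0 < e k) /\
  forall eps : F, 0 < eps -> exists N, forall k, (N <= k)%N -> e k < eps.

(** If p did not vanish at the limit z, it would have a constant sign near z,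
while it takes both signs at the end points of each interval. *)
Lemma dense_ivt (p : {poly K}) (a b : F) :
  a < b -> p.[f a] < 0 -> 0 < p.[f b] -> exists z : K, p.[z] = 0.
Proof.
move=> ab pa pb.
(* An interval is given by the pair of its end points. *)
pose good (s : F * F) := [/\ s.1 < s.2, p.[f s.1] < 0 & 0 < p.[f s.2]].
have [e [e0 elim0]] := F_null.
have /choice[next hnext] : forall ks : nat * (F * F), exists s' : F * F,
    good ks.2 ->
    [/\ good s', ks.2.1 <= s'.1, s'.2 <= ks.2.2 & s'.2 - s'.1 < e ks.1].
  move=> [k s]; have [[s12 p1 p2]|ng] := pselect (good s); last by exists s.
  have [x [y [? ? ? ? []]]] := sign_change_refine p _ _ _ s12 (e0 k) p1 p2.
  by exists (x, y).
pose fix st k := if k is k'.+1 then next (k', st k') else (a, b).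
have stgood k : good (st k).
  by elim: k => [|k IH] //=; have [] := hnext (k, st k) IH.
have stS k : [/\ (st k).1 <= (st k.+1).1, (st k.+1).2 <= (st k).2 &
                 (st k.+1).2 - (st k.+1).1 < e k].
  by have [] := hnext (k, st k) (stgood k).
have st1 : {homo (fun k => (st k).1) : m n / (m <= n)%N >-> m <= n}.
  by apply: homo_leq => [//|? ? ?|k]; [exact: le_trans|have [] := stS k].
have st2 : {homo (fun k => (st k).2) : m n / (m <= n)%N >-> n <= m}.
  by apply: homo_leq => [//|? ? ? h1 h2|k]; [exact: le_trans h2 h1|have [] := stS k].
have near k n : (k < n)%N -> `|(st n).1 - (st k.+1).1| <= e k /\
    `|(st n).1 - (st k.+1).2| <= e k.
  move=> kn; have [_ _ lk] := stS k; have [ln _ _] := stgood n.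
  have h1 := st1 _ _ kn; have h2 := st2 _ _ kn; rewrite /= in h1 h2.
  by rewrite !ler_norml; split; lra.
have xc : cauchy (fun k => (st k).1).
  move=> eps eps0.
  have [N hN] := elim0 (eps / 2) (divr_gt0 eps0 (ltr0Sn _ 1)).
  exists N => m n Nm Nn; have [hm _] := near _ _ Nm; have [hn _] := near _ _ Nn.
  have {hN} := hN N (leqnn _); move: hm hn; rewrite !ler_norml ltr_norml.
  by lra.
have [z hz] := f_complete _ xc; exists z; apply: contrapT => /eqP pz.
have [eta eta0 heta] : exists2 eta, 0 < eta & forall t, `|t - z| <= eta ->
    `|p.[t] - p.[z]| < `|p.[z]|.
  by apply: horner_continuous; rewrite normr_gt0.
have [eps eps0 epseta] := f_coinitial _ eta0.
have [N hN] := elim0 eps eps0.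
have eN : f (e N) <= eta.
  by rewrite (le_trans _ epseta) // f_le ltW // hN.
have [_ px py] := stgood N.+1.
have hx : `|p.[f (st N.+1).1] - p.[z]| < `|p.[z]|.
  apply: heta; rewrite distrC (le_trans _ eN) //; apply: hz.
  by exists N => n /near[].
have hy : `|p.[f (st N.+1).2] - p.[z]| < `|p.[z]|.
  apply: heta; rewrite distrC (le_trans _ eN) //; apply: hz.
  by exists N => n /near[].
move: hx hy; have [p0|p0] := leP 0 p.[z].
  by rewrite (ger0_norm p0) !ltr_norml; lra.
by rewrite (ltr0_norm p0) !ltr_norml; lra.
Qed.

(** For p monic of odd degree, - p(- X) is monic too, so both p and - p(- X) are
positive far to the right. *)
Lemma dense_odd_root (p : {poly K}) :
  odd (size p).-1 -> exists z : K, p.[z] = 0.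
Proof.
move=> podd; have p0 : p != 0 by apply: contraTN podd => /eqP->; rewrite size_poly0.
wlog pm : p podd p0 / p \is monic.
  have l0 : (lead_coef p)^-1 != 0 by rewrite invr_eq0 lead_coef_eq0.
  move=> /(_ ((lead_coef p)^-1 *: p)); rewrite size_scale // => /(_ podd).
  rewrite scaler_eq0 negb_or l0 p0 monicE lead_coefZ mulVf ?lead_coef_eq0 // eqxx.
  case=> // z; rewrite hornerZ => /eqP; rewrite mulf_eq0 (negbTE l0) => /eqP pz.
  by exists z.
pose q := - (p \Po (- 'X)).
have qE x : q.[x] = - p.[- x] by rewrite hornerN horner_comp hornerN hornerX.
have qm : q \is monic.
  rewrite monicE lead_coefN lead_coef_comp ?size_polyN ?size_polyX //.
  by rewrite (monicP pm) lead_coefN lead_coefX mul1r -signr_odd podd expr1 opprK.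
have [B hB] := monic_Cauchy_bound pm; have [B' hB'] := monic_Cauchy_bound qm.
have [M _ hM] := f_cofinal (Num.max 1 (Num.max B B')).
move: hM; rewrite !ge_max => /and3P[M1 MB MB'].
have M0 : 0 < M by rewrite -f_gt0 (lt_le_trans ltr01).
apply: (@dense_ivt p (- M) M); first by lra.
  by rewrite rmorphN -oppr_gt0 -qE hB'.
exact: hB.
Qed.

Lemma dense_sqrt (c : K) : 0 < c -> exists s : K, 0 < s /\ s ^+ 2 = c.
Proof.
move=> c0; have [M _ hM] := f_cofinal (c + 1).
have M0 : 0 < M by rewrite -f_gt0 (lt_le_trans _ hM) //; lra.
have [||z] := @dense_ivt ('X^2 - c%:P) 0 M M0.
- by rewrite !hornerE rmorph0 expr0n sub0r oppr_lt0.
- rewrite !hornerE subr_gt0 (lt_le_trans _ (_ : f M <= _)) //; first by lra.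
  by rewrite expr2 ler_peMl //; lra.
rewrite !hornerE => /eqP; rewrite subr_eq0 => /eqP zc.
exists `|z|; split; last by rewrite real_normK ?num_real.
by rewrite normr_gt0; apply: contraTN c0 => /eqP z0; rewrite -zc z0 expr0n ltxx.
Qed.

End DenseSubfield.

(** * The completion *)

Section Completion.
Variable F : realFieldType.
Local Notation K := (completion F).
Implicit Types (r e : F) (u v : cauchy_seq F) (x : K).

Lemma cst_cauchy r : (fun=> r) \in @cauchyb F.
Proof. by apply/asboolP => e e0; exists 0%N => m n _ _; rewrite subrr normr0. Qed.

Definition embed r : K := cclass (CauchySeq (cst_cauchy r)).

Lemma embed_is_zmod_morphism : zmod_morphism embed.
Proof.
by move=> r s; rewrite /embed -cclassN -cclassD; congr cclass; exact: val_inj.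
Qed.

Lemma embed_is_monoid_morphism : monoid_morphism embed.
Proof.
split; first by rewrite -cclass1; congr cclass; exact: val_inj.
by move=> r s; rewrite /embed -cclassM; congr cclass; exact: val_inj.
Qed.

HB.instance Definition _ :=
  GRing.isZmodMorphism.Build F K embed embed_is_zmod_morphism.
HB.instance Definition _ :=
  GRing.isMonoidMorphism.Build F K embed embed_is_monoid_morphism.

(** The bridge from termwise comparisons to the order of the completion; the
strict analogue is false, since the terms may get arbitrarily close. *)
Lemma le_cclass u v : (exists N, forall n, (N < n)%N -> val u n <= val v n) ->
  cclass u <= cclass v.
Proof.
move=> [N uv]; rewrite leNgt; apply/negP; rewrite -subr_gt0 -cclassN -cclassD.
move=> /cclass_gt0[e [e0 [N' he]]].
have := uv (maxn N N').+1 (leq_maxl _ _); rewrite -subr_le0.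
move=> /(lt_le_trans (he (maxn N N').+1 (leq_maxr _ _))).
by rewrite ltNge ltW.
Qed.

Lemma embed_gt0 r : (0 < embed r) = (0 < r).
Proof.
apply/idP/idP => [/cclass_gt0[e [e0 [N /(_ _ (ltnSn N))/=]]]|r0].
  exact: lt_trans.
apply/cclass_gt0; exists (r / 2); split; first by rewrite divr_gt0.
by exists 0%N => n _; change (r / 2 < r); lra.
Qed.

Lemma embed_lt r s : (embed r < embed s) = (r < s).
Proof. by rewrite -subr_gt0 -rmorphB embed_gt0 subr_gt0. Qed.

Lemma embed_le r s : (embed r <= embed s) = (r <= s).
Proof. by rewrite !leNgt embed_lt. Qed.

Lemma cclass_near u r e :
  (exists N, forall n, (N < n)%N -> `|val u n - r| <= e) ->
  `|cclass u - embed r| <= embed e.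
Proof.
move=> [N ur]; rewrite ler_distl -rmorphB -rmorphD; apply/andP; split.
  by apply: le_cclass; exists N => n /ur /=; rewrite ler_distl => /andP[].
by apply: le_cclass; exists N => n /ur /=; rewrite ler_distl => /andP[].
Qed.

Lemma embed_dense x e : 0 < e -> exists r, `|x - embed r| <= embed e.
Proof.
move=> e0; rewrite -[x]creprK; have [N hN] := cauchy_seqP (crepr x) e0.
exists (val (crepr x) N.+1); apply: cclass_near.
by exists N => n Nn; rewrite ltW // hN.
Qed.

Lemma embed_coinitial x : 0 < x -> exists2 e, 0 < e & embed e <= x.
Proof.
rewrite -[x]creprK => /cclass_gt0[e [e0 [N he]]]; exists e => //.
by apply: le_cclass; exists N => n /he/ltW.
Qed.

Lemma cauchy_has_limit (a : nat -> F) : cauchy a -> exists z : K, forall r e,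
  (exists N, forall n, (N < n)%N -> `|a n - r| <= e) ->
  `|z - embed r| <= embed e.
Proof.
move=> ca; have ac : a \in @cauchyb F by exact/asboolP.
by exists (cclass (CauchySeq ac)) => r e; exact: (cclass_near (CauchySeq ac)).
Qed.

End Completion.

(** With g an enumeration of F, the k-th term is the inverse of a number larger
than the first k + 1 values of g; it is below eps once g has listed the inverse
of eps. *)
Lemma countable_null_sequence (F : realFieldType) :
    countable [set: F] ->
  exists e : nat -> F, (forall k, 0 < e k) /\
  forall eps : F, 0 < eps -> exists N, forall k, (N <= k)%N -> e k < eps.
Proof.
move=> /countable_injP[f finj]; have {}finj x y : f x = f y -> x = y.
  by apply: finj; rewrite in_setT.
have /choice[g hg] : forall n, exists y, forall x, f x = n -> x = y.
  move=> n; have [[y <-]|no] := pselect (exists y, f y = n).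
    by exists y => x /finj.
  by exists 0 => x fx; case: no; exists x.
pose s k := 1 + \sum_(i < k.+1) `|g i|.
have s0 k : 0 < s k by rewrite ltr_pwDl // sumr_ge0.
exists (fun k => (s k)^-1); split=> [k|eps e0]; first by rewrite invr_gt0.
exists (f eps^-1) => k Nk; rewrite invf_plt ?posrE //.
rewrite /s (bigD1 (Ordinal (Nk : (f eps^-1 < k.+1)%N))) //= -(hg _ _ erefl).
rewrite gtr0_norm ?invr_gt0 //.
have : 0 <= \sum_(i < k.+1 | i != Ordinal (Nk : (f eps^-1 < k.+1)%N)) `|g i|.
  by rewrite sumr_ge0.
lra.
Qed.

Theorem theorem2p6 (Qstar : realFieldType)
    (hQ : nonstandard_rationals Qstar) (hcount : countable [set: Qstar]) :
  (forall c : completion Qstar, 0 < c ->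
     exists s : completion Qstar, 0 < s /\ s ^+ 2 = c) /\
  (forall p : {poly (completion Qstar)}, odd (size p).-1 ->
     exists a : completion Qstar, p.[a] = 0).
Proof.
have robust m : robust_ivt Qstar m by apply: robust_ivt_transfer; case: hQ.
have null := countable_null_sequence Qstar hcount.
have complete := cauchy_has_limit Qstar.
split;
  [apply: dense_sqrt robust complete null
  |apply: dense_odd_root robust complete null].
- exact: embed_le.
- exact: embed_coinitial.
- exact: embed_dense.
- exact: embed_le.
- exact: embed_coinitial.
- exact: embed_dense.
Qed.
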